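(* For any connected graph $G$ and any graph $H$, $$d(G\odot H)=d(H)+1.$$
   Context: All graphs are finite, undirected, without loops or multiple edges. For graphs $G$ and $H$, where $G$ has vertices $v_1,\dots,v_{n}$, the corona graph $G\odot H$ is obtained from one copy of $G$ and $n$ copies of $H$ by joining by an edge each vertex of the $i$-th copy of $H$ with the vertex $v_i$ of $G$. A set $D$ of vertices is dominating if every vertex not in $D$ has a neighbor in $D$. A domatic partition of a graph is a partition of its vertex set in which every set is a dominating set; the domatic number $d(G)$ is the maximum number of sets in a domatic partition of $G$. *)

(* Defs.v *)
From mathcomp Require Import all_boot.

Set Implicit Arguments.
Unset Strict Implicit.
Unset Printing Implicit Defensive.

Record sgraph := SGraph {
  vertex :> finType;
  adj : rel vertex;
  adj_sym : symmetric adj;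
  adj_irrefl : irreflexive adj }.

(* The null graph is not considered connected. *)
Definition connected_graph (G : sgraph) : bool :=
  (0 < #|G|) && [forall x : G, forall y : G, connect (@adj G) x y].

Section Corona.
Variables G H : sgraph.

(* [inl v] is the vertex v of G; [inr (v, h)] is the vertex h of the copy of H
   attached to v. *)
Definition corona_adj (a b : G + G * H) : bool :=
  match a, b with
  | inl u, inl v => adj u v
  | inl u, inr (v, _) => u == v
  | inr (u, _), inl v => u == v
  | inr (u, h), inr (v, k) => (u == v) && adj h k
  end.

Lemma corona_adj_sym : symmetric corona_adj.
Proof.
case=> [u|[u h]] [v|[v k]] //=; first exact: adj_sym.
by rewrite eq_sym adj_sym.
Qed.

Lemma corona_adj_irrefl : irreflexive corona_adj.
Proof. by case=> [u|[u h]] /=; rewrite adj_irrefl ?andbF. Qed.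

Definition corona : sgraph := SGraph corona_adj_sym corona_adj_irrefl.

End Corona.

Section Domatic.
Variable G : sgraph.

Definition dominating (D : {set G}) : bool :=
  [forall x : G, (x \notin D) ==> [exists y in D, adj x y]].

Definition domatic_partition (P : {set {set G}}) : bool :=
  partition P [set: G] && [forall D in P, dominating D].

Definition domatic_number : nat :=
  \max_(P : {set {set G}} | domatic_partition P) #|P|.

End Domatic.

(* Main.v *)
Require Import Defs.
From mathcomp Require Import all_boot.

(** A domatic partition with k classes is the same as a colouring by k colours
    whose fibres are all dominating.  Colour G with one new colour and every
    copy of H by an optimal colouring of H: this gives d(H) + 1 colours.
    Conversely, the closed neighbourhood of a vertex in the copy of H at v lies
    in that copy together with v, so every colour other than that of v dominates
    the copy; recolouring the vertices there that have the colour of v loses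
    only one colour. *)

Lemma dominatingP {G : sgraph} (D : {set G}) :
  reflect (forall x, x \in D \/ exists2 y, y \in D & adj x y) (dominating D).
Proof.
apply: (iffP forallP) => domD x.
  case: (boolP (x \in D)) => [|xD]; first by left.
  by right; apply/exists_inP; apply: implyP (domD x) xD.
by apply/implyP => /negP xD; apply/exists_inP; case: (domD x).
Qed.

Lemma dominating_neq0 {G : sgraph} {D : {set G}} :
  0 < #|G| -> dominating D -> D != set0.
Proof.
move=> /card_gt0P[x _] /dominatingP/(_ x) domx; apply/set0Pn.
by case: domx => [xD|[y yD _]]; [exists x | exists y].
Qed.

Lemma dominatingS {G : sgraph} {D E : {set G}} :
  D \subset E -> dominating D -> dominating E.
Proof.
move=> /subsetP sDE /dominatingP domD; apply/dominatingP => x.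
by case: (domD x) => [/sDE|[y /sDE yE xy]]; [left | right; exists y].
Qed.

(** On a nonempty graph the fibres, being dominating, are nonempty, so [f] is onto and [#|C|] counts
    the classes. *)
Definition domatic_colouring {G : sgraph} {C : finType} (f : G -> C) : Prop :=
  forall c, dominating [set x | f x == c].

(** Nonempty fibres over distinct colours are distinct, so the fibres form a domatic partition with
    exactly [#|C|] classes. *)
Lemma domatic_colouring_leq {G : sgraph} {C : finType} (f : G -> C) :
  0 < #|G| -> domatic_colouring f -> #|C| <= domatic_number G.
Proof.
move=> G0 domf; pose F c := [set x | f x == c].
have F_inj : injective F.
  move=> c d eqF; have /set0Pn[x xFc] := dominating_neq0 G0 (domf c).
  have: x \in F d by rewrite -eqF.
  by move: xFc; rewrite !inE => /eqP-> /eqP.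
rewrite -(card_imset C F_inj).
apply: (@leq_bigmax_cond _ (@domatic_partition G) (fun P => #|P|)).
apply/andP; split; last by apply/forall_inP => _ /imsetP[c _ ->]; apply: domf.
apply/and3P; split.
- apply/eqP/setP => x; rewrite inE; apply/bigcupP.
  by exists (F (f x)); [apply: imset_f | rewrite inE].
- apply/trivIsetP => _ _ /imsetP[c _ ->] /imsetP[d _ ->] neqF.
  rewrite -setI_eq0; apply/eqP/setP => x; rewrite !inE.
  by apply: contra_neqF neqF => /andP[/eqP<- /eqP<-].
- by apply/imsetP => -[c _ /esym/eqP]; apply/negP/(dominating_neq0 G0)/domf.
Qed.

Lemma domatic_colouring_exists {G : sgraph} :
  0 < #|G| -> exists (C : finType) (f : G -> C),
    #|C| = domatic_number G /\ domatic_colouring f.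
Proof.
move=> G0; have /card_gt0P[x0 _] := G0.
(* The one-class partition shows that the maximum is over a nonempty family, hence attained. *)
have domT : @domatic_partition G [set setT].
  apply/andP; split.
    rewrite /partition /trivIset /cover !big_set1 !eqxx inE eq_sym /=.
    by apply/set0Pn; exists x0.
  by apply/forall_inP => D /set1P->; apply/dominatingP => x; left.
have [|P /andP[partP /forall_inP domP] maxP] :=
    @eq_bigmax_cond _ (@domatic_partition G) (fun P => #|P|).
  by apply/card_gt0P; exists [set setT].
have [/eqP covP trivP _] := and3P partP.
have pblockP x : pblock P x \in P by rewrite pblock_mem // covP.
(* The colours are the blocks of an optimal partition; each vertex is coloured by its own block. *)
exists {D | D \in P}, (fun x => Sub (pblock P x) (pblockP x)).
split=> [|[D DP]]; first by rewrite card_sig /domatic_number maxP.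
apply: dominatingS (domP D DP); apply/subsetP => x xD.
by rewrite inE -val_eqE /= (def_pblock trivP DP xD).
Qed.

Lemma card_corona_gt0 (G H : sgraph) : 0 < #|G| -> 0 < #|corona G H|.
Proof. by move=> /card_gt0P[v _]; apply/card_gt0P; exists (inl v). Qed.

Lemma domatic_number_corona_geq (G H : sgraph) :
  0 < #|G| -> 0 < #|H| -> domatic_number H < domatic_number (corona G H).
Proof.
move=> G0 H0; have [C [f [<- domf]]] := domatic_colouring_exists H0.
(* [None] is the new colour, given to all of [G]. *)
pose g (a : corona G H) := if a is inr (_, h) then Some (f h) else None.
rewrite -card_option.
apply: (domatic_colouring_leq g); first exact: card_corona_gt0.
move=> c; apply/dominatingP; case: c => [c|] [v|[v h]]; rewrite inE /=.
- right; have /set0Pn[h] := dominating_neq0 H0 (domf c); rewrite inE => fh.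
  by exists (inr (v, h)) => //=; rewrite inE.
- have /dominatingP/(_ h)[|[k]] := domf c; rewrite inE => fk; first by left.
  by move=> hk; right; exists (inr (v, k)); rewrite ?inE //= eqxx.
- by left.
- by right; exists (inl v); rewrite ?inE /=.
Qed.

Lemma domatic_number_corona_leq (G H : sgraph) :
  0 < #|G| -> 0 < #|H| -> domatic_number (corona G H) <= (domatic_number H).+1.
Proof.
move=> G0 H0; have /card_gt0P[v _] := G0.
have [C [f [<- domf]]] := domatic_colouring_exists (card_corona_gt0 G H G0).
pose c0 := f (inl v); pose C' : finType := {c | c != c0}.
have -> : #|C| = #|C'|.+1.
  by rewrite card_sig (cardD1 c0); congr _.+1; apply: eq_card => c; rewrite !inE andbT.
(* With no colour besides [c0] the bound is trivial; otherwise [c1] is the replacement for [c0]. *)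
rewrite ltnS; have [->//|/card_gt0P[c1 _]] := posnP #|C'|.
(* [insubd] keeps every colour other than [c0] and turns [c0] into [c1], so the surviving classes
   can only grow. *)
pose g h : C' := insubd c1 (f (inr (v, h))).
have gE h (c : C') : f (inr (v, h)) = val c -> g h = c.
  by move=> fh; rewrite /g fh valKd.
apply: (domatic_colouring_leq g) => // c; apply/dominatingP => h.
(* Colour [c] is found at the vertex itself, at a neighbour in [G], which must be [v] and so has the
   excluded colour [c0], or at a neighbour in the same copy. *)
have /dominatingP/(_ (inr (v, h)))[|[[u|[u k]]]] := domf (val c).
- by rewrite inE => /eqP/gE ghc; left; rewrite inE ghc.
- rewrite inE => /eqP fu /= /eqP vu.
  by have := valP c; rewrite -fu -vu eqxx.
- rewrite inE => /eqP fk /= /andP[/eqP vu hk]; right; exists k => //.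
  by rewrite inE (gE k c) // vu.
Qed.

Theorem mainTheorem11 (G H : sgraph) (hG : connected_graph G) (hH : 0 < #|H|) :
  domatic_number (corona G H) = domatic_number H + 1.
Proof.
have /andP[G0 _] := hG; apply/eqP; rewrite addn1 eqn_leq.
by rewrite domatic_number_corona_leq ?domatic_number_corona_geq.
Qed.
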